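(* Let $(\Xi,d_\Xi)$ be a complete metric space with a group $\{\theta_t:t\in\mathbb{R}\}$ of continuous operators, let $g\in\Xi$ and $\Sigma=\mathcal{H}_\Xi(g)$. Let $\Sigma_-,\Sigma_+\subset\Xi$ be compact invariant sets, put $\Lambda=\Sigma\cup\Sigma_-\cup\Sigma_+$, and let $\{U_\sigma(t,s):t\ge s\}_{\sigma\in\Lambda}$ be a system of evolution processes in the Banach space $X$ with a closed, bounded, uniformly absorbing set $\mathcal{B}\subset X$. Suppose that $\{U_g(t,s):t\ge s\}$ has a pullback attractor $\{A(t):t\in\mathbb{R}\}$ with $D=\bigcup_{t\in\mathbb{R}}A(t)$ compact. Suppose that for all $t\ge1$, $\sigma_1,\sigma_2\in\Lambda$ and $x\in\mathcal{B}$, $$\|U_{\sigma_1}(t,0)x-U_{\sigma_2}(t,0)x\|_X\le L(t)\,d_\Xi(\sigma_1,\sigma_2),$$ where $1\le L(t)\le c_1e^{\beta t}$ for all $t\ge1$, for some constants $c_1,\beta>0$. Suppose there are constants $C\ge1$, $\eta_1,\eta_2>0$ such that for all $t\in\mathbb{R}$ $$\mathrm{dist}(\theta_tg,\Sigma_-)\le Ce^{\eta_1t},\qquad\mathrm{dist}(\theta_tg,\Sigma_+)\le Ce^{-\eta_2t}.$$ Moreover, suppose that there exist uniform exponential attractors $\mathcal{M}_{\Sigma_-}$ and $\mathcal{M}_{\Sigma_+}$ of the systems $\{U_\sigma(t,s)\}_{\sigma\in\Sigma_-}$ and $\{U_\sigma(t,s)\}_{\sigma\in\Sigma_+}$, and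 constants $\nu_1,\nu_2>0$ and $C(D)\ge1$, such that for all $t\ge0$ $$\sup_{\sigma\in\Sigma_-}\mathrm{dist}_H(U_\sigma(t,0)D,\mathcal{M}_{\Sigma_-})\le C(D)e^{-\nu_1t},\qquad\sup_{\sigma\in\Sigma_+}\mathrm{dist}_H(U_\sigma(t,0)D,\mathcal{M}_{\Sigma_+})\le C(D)e^{-\nu_2t}.$$ Then there are constants $\bar c\ge0$, $\xi>0$ and $\tilde T\ge0$ such that $$\mathrm{dist}_H(A(T),\mathcal{M}_{\Sigma_-})\le\bar c\,e^{\xi T}\quad\text{for all }T\le-\tilde T,$$ $$\mathrm{dist}_H(A(T),\mathcal{M}_{\Sigma_+})\le\bar c\,e^{-\xi T}\quad\text{for all }T\ge\tilde T.$$
   Context: $(X,\|\cdot\|_X)$ is a Banach space. An evolution process in $X$ is a family of continuous maps $U(t,s):X\to X$, $t\ge s$ real, with $U(s,s)=\mathrm{Id}_X$, $U(t,s)U(s,r)=U(t,r)$ for $t\ge s\ge r$, and such that for each $x\in X$ the map $(t,s)\mapsto U(t,s)x$ is continuous on $\{t\ge s\}$. A group of operators on $\Xi$ satisfies $\theta_0=\mathrm{Id}$, $\theta_t\theta_s=\theta_{t+s}$ for $t,s\in\mathbb{R}$. A set $\Sigma'\subset\Xi$ is invariant if $\theta_t\Sigma'=\Sigma'$ for all $t\in\mathbb{R}$. The hull of $g$ is $\mathcal{H}_\Xi(g)=\overline{\{\theta_rg:r\in\mathbb{R}\}}$ (closure in $\Xi$); symbol spaces, in particular $\Sigma$, are assumed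 compact. $\mathrm{dist}(\xi,S)=\inf_{\eta\in S}d_\Xi(\xi,\eta)$. A system of evolution processes $\{U_\sigma(t,s):t\ge s\}_{\sigma\in\Lambda}$, with $\Lambda\subset\Xi$ compact and invariant, is a family of evolution processes in $X$ such that $U_{\theta_h\sigma}(t,s)=U_\sigma(t+h,s+h)$ for all $\sigma\in\Lambda$, $t\ge s$, $h\in\mathbb{R}$. A set $\mathcal{B}\subset X$ is uniformly absorbing if for each bounded $B\subset X$ there is $t_B\ge0$ with $U_\sigma(t,0)B\subset\mathcal{B}$ for all $t\ge t_B$ and all symbols $\sigma$. $\mathrm{dist}_H(A,B)=\sup_{x\in A}\inf_{y\in B}\|x-y\|_X$. The pullback attractor of an evolution process $\{U(t,s)\}$ is a family $\{A(t):t\in\mathbb{R}\}$ of compact subsets of $X$ with $\bigcup_{t\in\mathbb{R}}A(t)$ bounded, $U(t,s)A(s)=A(t)$ for all $t\ge s$, and $\mathrm{dist}_H(U(t,s)B,A(t))\to0$ as $s\to-\infty$ for every $t\in\mathbb{R}$ and bounded $B\subset X$. A uniform exponential attractor for a system $\{U_\sigma(t,s)\}_{\sigma\in\Sigma'}$ is a compact set $\mathcal{M}\subset X$ of finite box-counting dimension such that for every bounded $B\subset X$, $\sup_{\sigma\in\Sigma'}\mathrm{dist}_H(U_\sigma(t,0)B,\mathcal{M})$ decays exponentially as $t\to\infty$. The box-counting dimension of a compact $K\subset X$ is $\limsup_{r\to0}\frac{\log N_X(K,r)}{-\log r}$, where $N_X(K,r)$ is the minimal number of open balls of radius $r$ in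 $X$ covering $K$. *)

(* Defs.v *)
From HB Require Import structures.
From mathcomp Require Import all_boot all_order all_algebra.
From mathcomp Require Import all_classical all_reals all_analysis.

Set Implicit Arguments.
Unset Strict Implicit.
Unset Printing Implicit Defensive.

Import Order.TTheory GRing.Theory Num.Theory.
Import numFieldNormedType.Exports.

Local Open Scope classical_set_scope.
Local Open Scope ring_scope.

(* For a metric space, completeness for Cauchy filters is completeness for
   Cauchy sequences. *)
Definition complete_space (T : uniformType) : Prop :=
  forall F : set_system T, ProperFilter F -> cauchy F -> exists x : T, F --> x.

Section Symbols.
Variables (R : realType) (Xi : metricType R).

(* The value is +oo when S is empty. *)
Definition dist_set (xi : Xi) (S : set Xi) : \bar R :=
  ereal_inf [set (mdist xi eta)%:E | eta in S].

Definition operator_group (theta : R -> Xi -> Xi) : Prop :=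
  [/\ forall t, continuous (theta t),
      forall xi, theta 0 xi = xi &
      forall t s xi, theta t (theta s xi) = theta (t + s) xi].

Definition invariant_set (theta : R -> Xi -> Xi) (S : set Xi) : Prop :=
  forall t, theta t @` S = S.

Definition hull (theta : R -> Xi -> Xi) (g : Xi) : set Xi :=
  closure [set theta r g | r in setT].

End Symbols.

Section Processes.
Variables (R : realType) (X : completeNormedModType R).

(* A two-parameter family of maps is a total function of (t, s); only its
   values for s <= t are meaningful. *)
Definition evolution_process (U : R -> R -> X -> X) : Prop :=
  [/\ forall t s, s <= t -> continuous (U t s),
      forall s x, U s s x = x,
      forall t s r x, r <= s -> s <= t -> U t s (U s r x) = U t r x &
      forall x, {within [set p : R * R | p.2 <= p.1],
                  continuous (fun p : R * R => U p.1 p.2 x)}].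

(* The outer supremum is taken in [0, +oo], so it is 0 when A is empty; the
   inner infimum is +oo when B is empty. *)
Definition hausdorff_semidist (A B : set X) : \bar R :=
  maxe 0%E (ereal_sup [set ereal_inf [set `|x - y|%:E | y in B] | x in A]).

Definition pullback_attractor (U : R -> R -> X -> X) (A : R -> set X) : Prop :=
  [/\ forall t, compact (A t),
      bounded_set (\bigcup_(t in [set: R]) A t),
      forall t s, s <= t -> U t s @` A s = A t &
      forall (t : R) (B : set X), bounded_set B ->
        hausdorff_semidist (U t s @` B) (A t) @[s --> -oo%R] --> 0%E].

(* +oo when K has no finite cover by balls of radius r. *)
Definition covering_number (K : set X) (r : R) : \bar R :=
  ereal_inf [set (n%:R)%:E | n in
    [set n : nat | exists s : seq X,
       size s = n /\ K `<=` \bigcup_(x in [set` s]) ball x r]].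

Definition box_dim (K : set X) : \bar R :=
  limf_esup (fun r : R => (lne (covering_number K r) * ((- ln r)^-1)%:E)%E)
            (0^'+).

End Processes.

Section Systems.
Variables (R : realType) (Xi : metricType R) (X : completeNormedModType R).

Definition process_system (theta : R -> Xi -> Xi) (Lambda : set Xi)
    (U : Xi -> R -> R -> X -> X) : Prop :=
  [/\ compact Lambda,
      invariant_set theta Lambda,
      forall sigma, Lambda sigma -> evolution_process (U sigma) &
      forall sigma t s h x, Lambda sigma -> s <= t ->
        U (theta h sigma) t s x = U sigma (t + h) (s + h) x].

Definition uniformly_absorbing (Lambda : set Xi)
    (U : Xi -> R -> R -> X -> X) (BB : set X) : Prop :=
  forall B : set X, bounded_set B ->
    exists2 tB : R, 0 <= tB &
      forall t sigma, tB <= t -> Lambda sigma -> U sigma t 0 @` B `<=` BB.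

Definition sup_dist (S : set Xi) (U : Xi -> R -> R -> X -> X)
    (B M : set X) (t : R) : \bar R :=
  ereal_sup [set hausdorff_semidist (U sigma t 0 @` B) M | sigma in S].

Definition uniform_exponential_attractor (S : set Xi)
    (U : Xi -> R -> R -> X -> X) (M : set X) : Prop :=
  [/\ compact M,
      (box_dim M < +oo)%E &
      forall B : set X, bounded_set B ->
        exists c omega : R, [/\ 0 <= c, 0 < omega &
          \forall t \near +oo,
            (sup_dist S U B M t <= (c * expR (- omega * t))%:E)%E]].

End Systems.

(* Main.v *)
(* By invariance A(T) = U_(theta_(T-t) g)(t, 0) A(T-t).  Replace the symbol
   theta_(T-t) g by a nearly closest one in the limit set S = Sigma_- or
   Sigma_+: since A(T-t) lies in D and in the absorbing set, A(T) is within
   L(t) dist(theta_(T-t) g, S) + CD e^(- nu t) of the attractor over S, up to a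
   factor 2.  Waiting a time t = gamma |T| proportional to |T|, with gamma small
   enough that the growth e^(beta t) of L does not compensate the decay of the
   distance to S, makes both terms exponentially small in |T|. *)
Require Import Defs.
From HB Require Import structures.
From mathcomp Require Import all_boot all_order all_algebra.
From mathcomp Require Import all_classical all_reals all_analysis.
From mathcomp Require Import ring lra.

Set Implicit Arguments.
Unset Strict Implicit.
Unset Printing Implicit Defensive.

Import Order.TTheory GRing.Theory Num.Theory.
Import numFieldNormedType.Exports.

Local Open Scope classical_set_scope.
Local Open Scope ring_scope.

Lemma dist_set_lt (R : realType) (Xi : metricType R) (xi : Xi) (S : set Xi)
    (d e : R) :
  (dist_set xi S <= d%:E)%E -> d < e ->
  exists2 eta, S eta & mdist xi eta < e.
Proof.
move=> le_d lt_de.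
have : (dist_set xi S < e%:E)%E by apply: le_lt_trans le_d _; rewrite lte_fin.
by move=> /ereal_inf_lt[_ [eta Seta <-]]; rewrite lte_fin; exists eta.
Qed.

Lemma hausdorff_semidist_lt (R : realType) (X : completeNormedModType R)
    (A B : set X) (d e : R) (x : X) :
  (hausdorff_semidist A B <= d%:E)%E -> d < e -> A x ->
  exists2 y, B y & `|x - y| < e.
Proof.
rewrite /hausdorff_semidist ge_max => /andP[_ le_d] lt_de Ax.
have : (ereal_inf [set `|x - y|%:E | y in B] < e%:E)%E.
  apply: (@le_lt_trans _ _ d%:E); last by rewrite lte_fin.
  by apply: le_trans le_d; apply: ereal_sup_ubound; exists x.
by move=> /ereal_inf_lt[_ [y By <-]]; rewrite lte_fin; exists y.
Qed.

(** The sign condition on [d] covers the case of an empty [A], whose semidistance is 0 by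
    convention. *)
Lemma hausdorff_semidist_le (R : realType) (X : completeNormedModType R)
    (A B : set X) (d : R) :
  0 <= d -> (forall x, A x -> exists2 y, B y & `|x - y| <= d) ->
  (hausdorff_semidist A B <= d%:E)%E.
Proof.
move=> d_ge0 AB; rewrite /hausdorff_semidist ge_max lee_fin d_ge0 /=.
apply: ge_ereal_sup => _ [x Ax <-]; have [y By xy] := AB x Ax.
apply: (@le_trans _ _ `|x - y|%:E); last by rewrite lee_fin.
by apply: ereal_inf_lbound; exists y.
Qed.

(** The union of all sections is bounded, hence absorbed after some time [tB]. Invariance and the
    shift relation exhibit [A t] as the image of [A (t - tB)] under [U (theta (t - tB) g) tB 0],
    which lands in [BB]. This makes the Lipschitz estimate in the symbol available on the
    attractor. *)
Lemma pullback_attractor_sub_absorbing (R : realType) (Xi : metricType R)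
    (X : completeNormedModType R) (theta : R -> Xi -> Xi) (Lambda : set Xi)
    (U : Xi -> R -> R -> X -> X) (g : Xi) (BB : set X) (A : R -> set X) :
  process_system theta Lambda U -> Lambda g ->
  uniformly_absorbing Lambda U BB ->
  pullback_attractor (U g) A -> forall t, A t `<=` BB.
Proof.
move=> [_ invL _ shiftU] Lg absBB [_ bndA invA _] t x Atx.
have [tB tB_ge0 abs] := absBB _ bndA.
have : A t x by [].
rewrite -(invA t (t - tB)); last by rewrite lerBlDr lerDl.
case=> y Ay <-; apply: (abs tB (theta (t - tB) g)) => //.
  by rewrite -(invL (t - tB)); exists g.
exists y; first by exists (t - tB).
by rewrite shiftU// addrC subrK add0r.
Qed.

Lemma attractor_semidist_le (R : realType) (Xi : metricType R)
    (X : completeNormedModType R) (theta : R -> Xi -> Xi) (Lambda S : set Xi)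
    (U : Xi -> R -> R -> X -> X) (g : Xi) (BB M : set X) (A : R -> set X)
    (t T l d e : R) :
  process_system theta Lambda U -> Lambda g -> S `<=` Lambda ->
  uniformly_absorbing Lambda U BB -> pullback_attractor (U g) A ->
  0 <= t -> 0 <= l -> 0 < d -> 0 < e ->
  (forall sigma1 sigma2 x, Lambda sigma1 -> Lambda sigma2 -> BB x ->
     `|U sigma1 t 0 x - U sigma2 t 0 x| <= l * mdist sigma1 sigma2) ->
  (dist_set (theta (T - t)%R g) S <= d%:E)%E ->
  (sup_dist S U (\bigcup_(s in [set: R]) A s) M t <= e%:E)%E ->
  (hausdorff_semidist (A T) M <= (l * (2 * d) + 2 * e)%:E)%E.
Proof.
move=> sysU Lg SL absBB attrA t_ge0 l_ge0 d_gt0 e_gt0 lip distS attrS.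
have subBB := pullback_attractor_sub_absorbing sysU Lg absBB attrA.
have [[_ invL _ shiftU] [_ _ invA _]] := (sysU, attrA).
apply: hausdorff_semidist_le => [|a].
  by rewrite addr_ge0// mulr_ge0// ?mulr_ge0// ltW.
rewrite -(invA T (T - t)); last by rewrite lerBlDr lerDl.
move=> [b Ab <-].
(* Infima yield a point only below a strictly larger bound; doubling the positive numbers [d] and
   [e] provides that room. *)
have lt_double (r : R) : 0 < r -> r < 2 * r by move=> ?; lra.
have [sigma Ssigma dsigma] := dist_set_lt distS (lt_double _ d_gt0).
have attr_sigma := le_trans (ereal_sup_ubound (imageP _ Ssigma)) attrS.
have Ub : (U sigma t 0 @` (\bigcup_(s in [set: R]) A s)) (U sigma t 0 b).
  by exists b => //; exists (T - t).
have [y My dy] := hausdorff_semidist_lt attr_sigma (lt_double _ e_gt0) Ub.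
exists y => //.
have -> : U g T (T - t) b = U (theta (T - t) g) t 0 b.
  by rewrite shiftU// (addrC t) subrK add0r.
(* The first leg changes the symbol from [theta (T - t) g] to [sigma] and is bounded by [lip]; the
   second is the attraction to [M]. *)
apply: le_trans (ler_distD (U sigma t 0 b) _ _) _.
apply: lerD; last exact: ltW.
apply: le_trans (lip _ _ _ _ _ _) _.
- by rewrite -(invL (T - t)); exists g.
- exact: SL.
- exact: subBB Ab.
- by rewrite ler_wpM2l// ltW.
Qed.

(** Here [tau] plays the role of [|T|], so that one statement serves both ends of time, and the
    waiting time is [gamma * tau]. The symbol term has exponent [((beta + eta) * gamma - eta) * tau]
    and the attraction term [- nu * gamma * tau]; the two conditions on [xi] bound both by
    [- xi * tau]. *)
Lemma attractor_semidist_expR (R : realType) (Xi : metricType R)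
    (X : completeNormedModType R) (theta : R -> Xi -> Xi) (Lambda S : set Xi)
    (U : Xi -> R -> R -> X -> X) (g : Xi) (BB M : set X) (A : R -> set X)
    (L : R -> R) (c1 beta C eta nu CD gamma xi tau T : R) :
  process_system theta Lambda U -> Lambda g -> S `<=` Lambda ->
  uniformly_absorbing Lambda U BB -> pullback_attractor (U g) A ->
  (forall t, 1 <= t -> 1 <= L t /\ L t <= c1 * expR (beta * t)) ->
  (forall t sigma1 sigma2 x, 1 <= t ->
     Lambda sigma1 -> Lambda sigma2 -> BB x ->
     `|U sigma1 t 0 x - U sigma2 t 0 x| <= L t * mdist sigma1 sigma2) ->
  0 < c1 -> 0 < C -> 0 < CD -> 1 <= gamma * tau -> 0 <= tau ->
  (beta + eta) * gamma + xi <= eta -> xi <= nu * gamma ->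
  (dist_set (theta (T - gamma * tau)%R g) S
     <= (C * expR (- eta * (tau - gamma * tau)))%:E)%E ->
  (sup_dist S U (\bigcup_(s in [set: R]) A s) M (gamma * tau)%R
     <= (CD * expR (- nu * (gamma * tau)))%:E)%E ->
  (hausdorff_semidist (A T) M
     <= ((2 * c1 * C + 2 * CD) * expR (- xi * tau))%:E)%E.
Proof.
move=> sysU Lg SL absBB attrA hL lip c1_gt0 C_gt0 CD_gt0 t_ge1 tau_ge0.
move=> le_eta le_nu distS attrS.
have [L_ge1 L_le] := hL _ t_ge1.
have L_ge0 : 0 <= L (gamma * tau) by lra.
apply: le_trans (attractor_semidist_le sysU Lg SL absBB attrA _ L_ge0 _ _
  (fun s1 s2 x => lip _ s1 s2 x t_ge1) distS attrS) _.
- lra.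
- by rewrite mulr_gt0// expR_gt0.
- by rewrite mulr_gt0// expR_gt0.
rewrite lee_fin (mulrDl (2 * c1 * C)) lerD//; last first.
  rewrite mulrA ler_pM2l ?mulr_gt0// ler_expR mulrA !mulNr lerN2.
  by rewrite ler_wpM2r.
apply: (@le_trans _ _ (c1 * expR (beta * (gamma * tau)) *
    (2 * (C * expR (- eta * (tau - gamma * tau)))))).
  by rewrite ler_wpM2r// !mulr_ge0// ?expR_ge0// ltW.
have -> : c1 * expR (beta * (gamma * tau)) *
    (2 * (C * expR (- eta * (tau - gamma * tau)))) =
    2 * c1 * C * (expR (beta * (gamma * tau)) *
      expR (- eta * (tau - gamma * tau))) by ring.
rewrite ler_pM2l ?mulr_gt0// -expRD ler_expR.
have := ler_wpM2r tau_ge0 le_eta; lra.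
Qed.

Theorem proposition4p1 (R : realType) (X : completeNormedModType R)
    (Xi : metricType R) (hXi : complete_space Xi)
    (theta : R -> Xi -> Xi) (htheta : operator_group theta)
    (g : Xi) (Sigma : set Xi) (hSigma : Sigma = hull theta g)
    (cptSigma : compact Sigma)
    (SigmaM SigmaP : set Xi)
    (cptM : compact SigmaM) (invM : invariant_set theta SigmaM)
    (cptP : compact SigmaP) (invP : invariant_set theta SigmaP)
    (Lambda : set Xi) (hLambda : Lambda = Sigma `|` SigmaM `|` SigmaP)
    (U : Xi -> R -> R -> X -> X) (hU : process_system theta Lambda U)
    (BB : set X) (BBclosed : closed BB) (BBbounded : bounded_set BB)
    (BBabs : uniformly_absorbing Lambda U BB)
    (A : R -> set X) (hA : pullback_attractor (U g) A)
    (D : set X) (hD : D = \bigcup_(t in [set: R]) A t) (cptD : compact D)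
    (L : R -> R) (c1 beta : R) (c1_gt0 : 0 < c1) (beta_gt0 : 0 < beta)
    (hL : forall t : R, 1 <= t -> 1 <= L t /\ L t <= c1 * expR (beta * t))
    (lipU : forall (t : R) sigma1 sigma2 x, 1 <= t ->
       Lambda sigma1 -> Lambda sigma2 -> BB x ->
       `|U sigma1 t 0 x - U sigma2 t 0 x| <= L t * mdist sigma1 sigma2)
    (C eta1 eta2 : R) (C_ge1 : 1 <= C) (eta1_gt0 : 0 < eta1)
    (eta2_gt0 : 0 < eta2)
    (distM : forall t : R,
       (dist_set (theta t g) SigmaM <= (C * expR (eta1 * t))%:E)%E)
    (distP : forall t : R,
       (dist_set (theta t g) SigmaP <= (C * expR (- eta2 * t))%:E)%E)
    (MM MP : set X)
    (hMM : uniform_exponential_attractor SigmaM U MM)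
    (hMP : uniform_exponential_attractor SigmaP U MP)
    (nu1 nu2 CD : R) (nu1_gt0 : 0 < nu1) (nu2_gt0 : 0 < nu2) (CD_ge1 : 1 <= CD)
    (attrM : forall t : R, 0 <= t ->
       (sup_dist SigmaM U D MM t <= (CD * expR (- nu1 * t))%:E)%E)
    (attrP : forall t : R, 0 <= t ->
       (sup_dist SigmaP U D MP t <= (CD * expR (- nu2 * t))%:E)%E) :
  exists cbar xi Ttilde : R,
    [/\ 0 <= cbar, 0 < xi, 0 <= Ttilde,
        forall T : R, T <= - Ttilde ->
          (hausdorff_semidist (A T) MM <= (cbar * expR (xi * T))%:E)%E &
        forall T : R, Ttilde <= T ->
          (hausdorff_semidist (A T) MP <= (cbar * expR (- xi * T))%:E)%E].
Proof.
have Lg r : Lambda (theta r g).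
  by rewrite hLambda hSigma; left; left; apply: subset_closure; exists r.
have Lg0 : Lambda g by case: htheta => _ id0 _; rewrite -(id0 g).
have SML : SigmaM `<=` Lambda by move=> s; rewrite hLambda; left; right.
have SPL : SigmaP `<=` Lambda by move=> s; rewrite hLambda; right.
have C_gt0 : 0 < C by lra.
have CD_gt0 : 0 < CD by lra.
subst D; clear hSigma hLambda.
(* The slower of the two rates is used at both ends, so that [gamma] and [xi] are common to them. *)
pose eta := Num.min eta1 eta2; pose nu := Num.min nu1 nu2.
have [eta_gt0 nu_gt0] : 0 < eta /\ 0 < nu by rewrite !lt_min; split; apply/andP.
have [le_eta1 le_eta2] : eta <= eta1 /\ eta <= eta2.
  by rewrite !ge_min !lexx orbT.
have [le_nu1 le_nu2] : nu <= nu1 /\ nu <= nu2 by rewrite !ge_min !lexx orbT.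
(* With this [gamma], the growth of [L] and the time shift together cost exactly half of the rate
   [eta]; the other half is left for [xi]. *)
pose gamma := eta / (2 * (beta + eta)).
have gamma_gt0 : 0 < gamma by rewrite divr_gt0// mulr_gt0// addr_gt0.
have gammaE : (beta + eta) * gamma = eta / 2 by rewrite /gamma; field; lra.
have gamma_le1 : gamma <= 1 by rewrite /gamma ler_pdivrMr; nra.
pose xi := Num.min (eta / 2) (nu * gamma).
have [xi_eta xi_nu] : xi <= eta / 2 /\ xi <= nu * gamma.
  by rewrite !ge_min !lexx orbT.
have rate : (beta + eta) * gamma + xi <= eta by lra.
have expM_mono (c a b x : R) : 0 < c -> a <= b -> 0 <= x ->
    ((c * expR (- b * x))%:E <= (c * expR (- a * x))%:E)%E.
  by move=> ? ? ?; rewrite lee_fin ler_pM2l// ler_expR !mulNr lerN2 ler_wpM2r.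
(* The threshold [gamma^-1] makes the waiting time at least 1, where the bounds on [L] and the
   Lipschitz estimate hold. *)
have large (tau : R) : gamma^-1 <= tau -> [/\ 0 <= tau, 1 <= gamma * tau,
    0 <= gamma * tau & gamma * tau <= tau].
  move=> htau; have tau_ge0 : 0 <= tau.
    by apply: le_trans htau; rewrite invr_ge0 ltW.
  have t_ge1 : 1 <= gamma * tau by rewrite mulrC -ler_pdivrMr// div1r.
  by split=> //; [exact: le_trans t_ge1|rewrite ler_piMl].
exists (2 * c1 * C + 2 * CD), xi, gamma^-1; split.
- by rewrite addr_ge0// !mulr_ge0// ltW.
- by rewrite lt_min divr_gt0// mulr_gt0.
- by rewrite invr_ge0 ltW.
- move=> T leT.
  have [] := large (- T); first by rewrite lerNr.
  move=> T_ge0 t_ge1 t_ge0 t_le.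
  rewrite (_ : xi * T = - xi * - T); last by rewrite mulrNN.
  apply: (attractor_semidist_expR (eta := eta) (nu := nu) (gamma := gamma)
    hU Lg0 SML BBabs hA hL lipU) => //.
  + apply: (le_trans (distM _)).
    (* In the past, waiting moves the initial symbol even closer to [SigmaM]: the decay over
       [tau + gamma * tau], with [tau = - T], is weakened to the required decay over
       [tau - gamma * tau]. *)
    rewrite (_ : eta1 * _ = - eta1 * (- T + gamma * - T)); last by ring.
    apply: (@le_trans _ _ (C * expR (- eta * (- T + gamma * - T)))%:E).
      by apply: expM_mono => //; lra.
    rewrite lee_fin ler_pM2l// ler_expR !mulNr lerN2 ler_wpM2l//; lra.
  + apply: (le_trans (attrM _ t_ge0)); exact: expM_mono.
- move=> T leT; have [T_ge0 t_ge1 t_ge0 t_le] := large T leT.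
  apply: (attractor_semidist_expR (eta := eta) (nu := nu) (gamma := gamma)
    hU Lg0 SPL BBabs hA hL lipU) => //.
  (* In the future, waiting costs decay; [gamma * T <= T] keeps the initial time [T - gamma * T]
     nonnegative, so [eta2] may be lowered to [eta]. *)
  + apply: (le_trans (distP _)); apply: expM_mono => //; lra.
  + apply: (le_trans (attrP _ t_ge0)); exact: expM_mono.
Qed.
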